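(* Let $\mathcal{P}(A_i,b_i)\subset\mathbb{R}^d$, $i\in\{1,\ldots,n\}$, be polytopes each fulfilling Assumption 1 (required flexibility) and Assumption 2 (projection feasibility), and let $\mathcal{M}$ be their Minkowski sum. Then for every $j\in\{-1,1\}^d$ the summed extreme action $v^j=\sum_{i=1}^n y_i^j\in\mathbb{R}^d$ is a vertex of $\mathcal{M}$.
   Context: Here $d,n\in\mathbb{N}=\{1,2,\ldots\}$. For a matrix $A\in\mathbb{R}^{k\times d}$ and $b\in\mathbb{R}^k$, $\mathcal{P}(A,b)=\{x\in\mathbb{R}^d: Ax\le b\}$; it is called a polytope if it is bounded. $\mathbf{0}_m$ is the zero vector of dimension $m$. For $x\in\mathbb{R}^d$ and $t\le d$, $\mathrm{Proj}^t(x)=(x_1,\ldots,x_t,\mathbf{0}_{d-t})^\top\in\mathbb{R}^d$, and $x_{[t]}\in\mathbb{R}^t$ denotes the vector of the first $t$ components of $x$. The Minkowski sum of $\mathcal{P}(A_1,b_1),\ldots,\mathcal{P}(A_n,b_n)$ is $\mathcal{M}=\{\sum_{i=1}^n x_i : x_i\in\mathcal{P}(A_i,b_i)\}$. Assumption 1 (required flexibility) for $\mathcal{P}(A,b)\subset\mathbb{R}^d$: for every $t\in\{1,\ldots,d-1\}$ and every $x$ with $\mathrm{Proj}^t(x)\in\mathcal{P}(A,b)$ there exists $\varepsilon\in\mathbb{R}\setminus\{0\}$ such that $(x_1,\ldots,x_t,\varepsilon,\mathbf{0}_{d-(t+1)})^\top\in\mathcal{P}(A,b)$; furthermore there exists $\varepsilon\in\mathbb{R}\setminus\{0\}$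 such that $(\varepsilon,\mathbf{0}_{d-1})^\top\in\mathcal{P}(A,b)$. Assumption 2 (projection feasibility) for $\mathcal{P}(A,b)$: if $x\in\mathcal{P}(A,b)$, then $\mathrm{Proj}^t(x)\in\mathcal{P}(A,b)$ for all $t\in\{1,\ldots,d-1\}$; furthermore $\mathbf{0}_d\in\mathcal{P}(A,b)$. Extreme actions: for $j\in\{-1,1\}^d$ and $i\in\{1,\ldots,n\}$, the vector $y_i^j\in\mathbb{R}^d$ is defined recursively by $y_{i,1}^j=j_1\cdot\max\{j_1\cdot x\in\mathbb{R}:(x,\mathbf{0}_{d-1})^\top\in\mathcal{P}(A_i,b_i)\}$ and, for $t\in\{2,\ldots,d\}$, $y_{i,t}^j=j_t\cdot\max\{j_t\cdot x\in\mathbb{R}:(y^j_{i,[t-1]},x,\mathbf{0}_{d-t})^\top\in\mathcal{P}(A_i,b_i)\}$. The summed extreme action is $v^j=\sum_{i=1}^n y_i^j$. A point $v$ of a convex set $\mathcal{X}$ is a vertex of $\mathcal{X}$ if it is not of the form $v=\lambda p+(1-\lambda)q$ with $p,q\in\mathcal{X}$, $p\neq q$, $\lambda\in(0,1)$. *)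

(* Defs.v *)
From mathcomp Require Import all_boot all_order all_algebra.
From mathcomp Require Import all_classical all_reals all_analysis.

Set Implicit Arguments.
Unset Strict Implicit.
Unset Printing Implicit Defensive.

Import Order.TTheory GRing.Theory Num.Theory.
Import numFieldNormedType.Exports.

Local Open Scope classical_set_scope.
Local Open Scope ring_scope.

Definition polyhedron (R : realType) (k d : nat) (A : 'M[R]_(k, d))
    (b : 'cV[R]_k) : set 'cV[R]_d :=
  [set x | forall r : 'I_k, (A *m x) r 0 <= b r 0].

Definition minkowski_sum (R : realType) (n d : nat)
    (P : 'I_n -> set 'cV[R]_d) : set 'cV[R]_d :=
  [set \sum_i x i | x in [set x : 'I_n -> 'cV[R]_d | forall i, P i (x i)]].

Definition is_vertex (R : realType) (d : nat) (X : set 'cV[R]_d)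
    (v : 'cV[R]_d) : Prop :=
  X v /\
  ~ exists p q (l : R), [/\ X p, X q, p <> q, 0 < l < 1 &
                           v = l *: p + (1 - l) *: q].

Definition proj (R : realType) (d t : nat) (x : 'cV[R]_d) : 'cV[R]_d :=
  \col_k (if (k < t)%N then x k 0 else 0).

(* [append t x e] is (x_1, ..., x_t, e, 0, ..., 0); it is only used for t < d.
   Coordinates are numbered from 0, so e sits at index t. *)
Definition append (R : realType) (d t : nat) (x : 'cV[R]_d) (e : R) :
    'cV[R]_d :=
  \col_k (if (k < t)%N then x k 0 else if k == t :> nat then e else 0).

Definition required_flexibility (R : realType) (d : nat)
    (P : set 'cV[R]_d) : Prop :=
  (forall (t : nat) (x : 'cV[R]_d), (1 <= t <= d.-1)%N -> P (proj t x) ->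
     exists e : R, e <> 0 /\ P (append t x e)) /\
  (exists e : R, e <> 0 /\ P (append 0 0 e)).

Definition projection_feasibility (R : realType) (d : nat)
    (P : set 'cV[R]_d) : Prop :=
  (forall (x : 'cV[R]_d), P x ->
     forall t : nat, (1 <= t <= d.-1)%N -> P (proj t x)) /\
  P 0.

(* The greatest element of A, with junk value 0 if there is none. *)
Definition setmax (R : realType) (A : set R) : R := xget 0 (A `&` ubound A).

Lemma setmaxE (R : realType) (A : set R) (m : R) :
  A m -> ubound A m -> setmax A = m.
Proof.
move=> Am ubm; apply: xget_unique => // m' [Am' ubm'].
by apply/le_anti; rewrite ubm //= ubm'.
Qed.

(* The extreme action after its first t coordinates have been chosen, the
   remaining ones being 0. *)
Fixpoint extreme_prefix (R : realType) (d : nat) (P : set 'cV[R]_d)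
    (j : 'cV[R]_d) (t : nat) : 'cV[R]_d :=
  if t is s.+1 then
    let y := extreme_prefix P j s in
    \col_k (if k == s :> nat
            then j k 0 * setmax [set j k 0 * x | x in [set x | P (append s y x)]]
            else y k 0)
  else 0.

Definition extreme_action (R : realType) (d : nat) (P : set 'cV[R]_d)
    (j : 'cV[R]_d) : 'cV[R]_d := extreme_prefix P j d.

Lemma extreme_prefix_stable (R : realType) (d : nat) (P : set 'cV[R]_d)
    (j : 'cV[R]_d) (s t : nat) (k : 'I_d) :
  (k < s <= t)%N -> extreme_prefix P j t k 0 = extreme_prefix P j s k 0.
Proof.
elim: t => [|t IH] /andP[ks st]; first by move: (leq_trans ks st).
move: st; rewrite leq_eqVlt => /predU1P[<- //|st].
rewrite /= mxE ltn_eqF ?IH ?ks //; exact: leq_trans ks st.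
Qed.

(* This equation for all t characterizes [extreme_action]: the right-hand side
   depends only on the coordinates of y before t. *)
Lemma extreme_actionE (R : realType) (d : nat) (P : set 'cV[R]_d)
    (j : 'cV[R]_d) (t : 'I_d) (y := extreme_action P j) :
  y t 0 = j t 0 * setmax [set j t 0 * x | x in [set x | P (append t y x)]].
Proof.
rewrite /y /extreme_action (@extreme_prefix_stable _ _ _ _ t.+1) ?ltnS ?leqnn //=.
rewrite mxE eqxx; congr (_ * setmax (image _ _)).
apply/funext => x /=; congr P; apply/colP => k; rewrite !mxE.
case: ifP => // kt; apply/esym; apply: extreme_prefix_stable.
by rewrite kt ltnW.
Qed.

(* Main.v *)
Require Import Defs.
From mathcomp Require Import all_boot all_order all_algebra.
From mathcomp Require Import all_classical all_reals all_analysis.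
From mathcomp Require Import ring.
Import Order.TTheory GRing.Theory Num.Theory.
Import numFieldNormedType.Exports.
Local Open Scope classical_set_scope.
Local Open Scope ring_scope.

(** By projection feasibility, the one-dimensional maximum defining coordinate
    [t] of an extreme action is also the maximum of [j_t x_t] over all points of
    the polytope sharing its first [t - 1] coordinates.  An extreme action is
    thus the lexicographic maximizer of [(j_1 x_1, ..., j_d x_d)].  Lexicographic
    maximizers add up under Minkowski sums, and a lexicographic maximizer is a
    vertex. *)

Definition lex_maximal {R : realType} {d : nat} (j : 'cV[R]_d)
    (X : set 'cV[R]_d) (y : 'cV[R]_d) : Prop :=
  X y /\ forall (x : 'cV[R]_d) (t : 'I_d), X x ->
    (forall s : 'I_d, (s < t)%N -> x s 0 = y s 0) ->
    j t 0 * x t 0 <= j t 0 * y t 0.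

(** Induction on the coordinates: once [p] and [q] agree with [v] before [s], maximality bounds both
    [j s 0 * p s 0] and [j s 0 * q s 0] by [j s 0 * v s 0]. The two nonnegative gaps, taken with
    positive weights, sum to zero, so both vanish. *)
Lemma lex_maximal_vertex {R : realType} {d : nat} (j : 'cV[R]_d)
    (X : set 'cV[R]_d) (v : 'cV[R]_d) :
  (forall t, j t 0 != 0) -> lex_maximal j X v -> is_vertex X v.
Proof.
move=> j0 [Xv vmax]; split=> // -[p [q [l [Xp Xq pq /andP[l0 l1] vE]]]].
suff pqv m : forall s : 'I_d, (s < m)%N -> p s 0 = v s 0 /\ q s 0 = v s 0.
  by apply: pq; apply/colP => s; have [-> ->] := pqv s.+1 s (leqnn _).
elim: m => // m IH s; rewrite ltnS leq_eqVlt => /predU1P[sm|]; last exact: IH.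
have hp : j s 0 * p s 0 <= j s 0 * v s 0.
  by apply: vmax => // u; rewrite sm => /IH[].
have hq : j s 0 * q s 0 <= j s 0 * v s 0.
  by apply: vmax => // u; rewrite sm => /IH[].
have hv : v s 0 = l * p s 0 + (1 - l) * q s 0 by rewrite {1}vE !mxE.
have l1' : 0 < 1 - l by rewrite subr_gt0.
have hs : l * (j s 0 * v s 0 - j s 0 * p s 0) +
          (1 - l) * (j s 0 * v s 0 - j s 0 * q s 0) = 0.
  by rewrite hv; ring.
move/eqP: hs; rewrite paddr_eq0; try by rewrite mulr_ge0 ?subr_ge0 // ltW.
rewrite -!mulrBr !mulf_eq0 (gt_eqF l0) (gt_eqF l1') (negPf (j0 s)) /= !subr_eq0.
by move=> /andP[/eqP -> /eqP ->].
Qed.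

(** The crux is that agreement of the sums before [t] forces agreement of every pair of summands
    there ([agree]). Maximality of each [y i] then applies at [t], and the inequalities add up. *)
Lemma lex_maximal_minkowski_sum {R : realType} {d n : nat} (j : 'cV[R]_d)
    (P : 'I_n -> set 'cV[R]_d) (y : 'I_n -> 'cV[R]_d) :
  (forall t, j t 0 != 0) -> (forall i, lex_maximal j (P i) (y i)) ->
  lex_maximal j (minkowski_sum P) (\sum_i y i).
Proof.
move=> j0 ymax; split; first by exists y => // i; case: (ymax i).
move=> _ t [x Px <-] xy.
have step (s : 'I_d) : (forall i (u : 'I_d), (u < s)%N -> x i u 0 = y i u 0) ->
    forall i, j s 0 * x i s 0 <= j s 0 * y i s 0.
  by move=> xys i; apply: (ymax i).2 => // u; apply: xys.
have agree m : (m <= t)%N ->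
    forall i (u : 'I_d), (u < m)%N -> x i u 0 = y i u 0.
  elim: m => // m IH mt i u.
  rewrite ltnS leq_eqVlt => /predU1P[um|]; last by apply: IH; exact: ltnW.
  have le_u i' : j u 0 * x i' u 0 <= j u 0 * y i' u 0.
    by apply: step => i'' w; rewrite um; apply: IH; exact: ltnW.
  (* The sums agree at [u], so these gaps, each nonnegative by [le_u], have total zero and vanish
     one by one. *)
  have sum0 : \sum_i' (j u 0 * y i' u 0 - j u 0 * x i' u 0) = 0.
    rewrite sumrB -!mulr_sumr -!summxE xy ?subrr //.
    by rewrite um.
  have /eqP : j u 0 * y i u 0 - j u 0 * x i u 0 = 0.
    by apply: (psumr_eq0P _ sum0) => // i' _; rewrite subr_ge0.
  by rewrite -mulrBr mulf_eq0 (negPf (j0 u)) subr_eq0 => /eqP.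
rewrite !summxE !mulr_sumr; apply: ler_sum => i _.
exact: step (agree t (leqnn t)) i.
Qed.

(** Rules out the junk value of [setmax]: [S] is nonempty, closed and bounded above, so it contains
    its supremum. *)
Lemma setmax_attained {R : realType} {k d : nat} (A : 'M[R]_(k, d))
    (b : 'cV[R]_k) (y : 'cV[R]_d) (t : 'I_d) (c : R) :
  c = -1 \/ c = 1 -> bounded_set (polyhedron A b) ->
  polyhedron A b (append t y 0) ->
  let S := [set c * x | x in [set x | polyhedron A b (append t y x)]] in
  S (setmax S) /\ ubound S (setmax S).
Proof.
move=> hc bndP P0 S.
have c2 : c * c = 1 by case: hc => ->; rewrite ?mulrNN mulr1.
pose e : 'cV[R]_d := \col_k (k == t)%:R.
have appendE z : append t y z = append t y 0 + z *: e.
  apply/colP => u; rewrite !mxE -val_eqE /=.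
  by case: ltngtP => _; rewrite ?mulr0 ?addr0 ?mulr1 ?add0r.
(* Since [c] is its own inverse, substituting [c * z] for [x] turns each row of the system into a
   closed condition affine in [z]. *)
have SE : S = \bigcap_(r in [set: 'I_k])
    [set z | (A *m append t y 0) r 0 + z * (c * (A *m e) r 0) <= b r 0].
  have coordE x r : (A *m append t y x) r 0 =
      (A *m append t y 0) r 0 + x * (A *m e) r 0.
    by rewrite appendE mulmxDr -scalemxAr !mxE.
  apply/seteqP; split=> [_ [x Px <-] r _|z zP] /=.
    by rewrite mulrCA mulrA [c * (c * _)]mulrA c2 mul1r -coordE; exact: Px.
  exists (c * z); last by rewrite mulrA c2 mul1r.
  move=> r; rewrite coordE [c * z]mulrC -mulrA; exact: zP.
have Sclosed : closed S.
  rewrite SE; apply: closed_bigI => r _.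
  apply: (@closed_comp _ _ (fun z : R => (A *m append t y 0) r 0 +
    z * (c * (A *m e) r 0)) [set x | x <= b r 0]); last exact: closed_le.
  move=> z _; apply: cvgD; first exact: cvg_cst.
  by apply: cvgMl; exact: cvg_id.
have Subound : has_ubound S.
  (* [hM] bounds norms only by numbers strictly above [M], hence [M + 1]. The norm is the largest
     absolute value of an entry, so it dominates entry [t]. *)
  have [M [_ hM]] := bndP; exists (M + 1) => _ [x Px <-].
  apply: le_trans (hM (M + 1) _ _ Px); last by rewrite ltrDl.
  apply: (@le_trans _ _ `|append t y x t 0|).
    rewrite mxE ltnn eqxx (le_trans (ler_norm _)) // normrM.
    by case: hc => ->; rewrite ?normrN normr1 mul1r.
  rewrite /Num.norm /= mx_normrE.
  exact: (le_bigmax _ (fun ij : 'I_d * 'I_1 => `|append t y x ij.1 ij.2|) (t, 0)).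
have S0 : S !=set0 by exists (c * 0), 0.
have Ssup : S (sup S) by rewrite [X in X _](closure_id _).1 //; exact: closure_sup.
have Sub : ubound S (sup S) by exact: ub_le_sup.
by rewrite (setmaxE Ssup Sub).
Qed.

Lemma extreme_prefix0 {R : realType} {d : nat} (P : set 'cV[R]_d)
    (j : 'cV[R]_d) (t : nat) (s : 'I_d) :
  (t <= s)%N -> extreme_prefix P j t s 0 = 0.
Proof.
elim: t => [|t IH] ts; first by rewrite mxE.
by rewrite /= mxE gtn_eqF // IH // ltnW.
Qed.

Lemma append_extreme_prefix {R : realType} {d : nat} (P : set 'cV[R]_d)
    (j : 'cV[R]_d) (t : nat) :
  append t (extreme_prefix P j t) 0 = extreme_prefix P j t.
Proof.
apply/colP => s; rewrite mxE; case: ltnP => // ts.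
by rewrite extreme_prefix0 // if_same.
Qed.

(** A feasible prefix, read as an [append] of 0, makes the next slice nonempty. The maximum there is
    attained, and the point attaining it is the next prefix. *)
Lemma extreme_prefix_in {R : realType} {k d : nat} (A : 'M[R]_(k, d))
    (b : 'cV[R]_k) (j : 'cV[R]_d) (t : nat) :
  (forall s : 'I_d, j s 0 = -1 \/ j s 0 = 1) ->
  bounded_set (polyhedron A b) -> polyhedron A b 0 -> (t <= d)%N ->
  polyhedron A b (extreme_prefix (polyhedron A b) j t).
Proof.
move=> hj bndP P0; set P := polyhedron A b; elim: t => // t IH td.
have Pt := IH (ltnW td); pose u := Ordinal td.
rewrite -append_extreme_prefix in Pt.
have [[x Px xE] _] := setmax_attained A b _ u _ (hj u) bndP Pt.
suff -> : extreme_prefix P j t.+1 = append u (extreme_prefix P j t) x by [].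
apply/colP => s; rewrite !mxE; case: ltngtP => [//|ts|st].
- by rewrite extreme_prefix0 // ltnW.
- have -> : s = u by apply/val_inj.
  by rewrite -xE mulrA; case: (hj u) => ->; rewrite ?mulrNN !mul1r.
Qed.

Lemma extreme_action_lex_maximal {R : realType} {k d : nat}
    (A : 'M[R]_(k, d)) (b : 'cV[R]_k) (j : 'cV[R]_d) :
  (forall s : 'I_d, j s 0 = -1 \/ j s 0 = 1) ->
  bounded_set (polyhedron A b) -> projection_feasibility (polyhedron A b) ->
  lex_maximal j (polyhedron A b) (extreme_action (polyhedron A b) j).
Proof.
move=> hj bndP [projP P0]; split; first exact: extreme_prefix_in.
move=> x t Px xy; rewrite extreme_actionE.
set P := polyhedron A b; set y := extreme_action P j.
have appendy z : append t y z = append t (extreme_prefix P j t) z.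
  apply/colP => s; rewrite !mxE; case: ifP => // st.
  by apply: extreme_prefix_stable; rewrite st ltnW.
have Pt : P (append t y 0).
  rewrite appendy append_extreme_prefix.
  by apply: extreme_prefix_in => //; exact: ltnW.
have [_ ub] := setmax_attained A b y t _ (hj t) bndP Pt.
have -> z : j t 0 * (j t 0 * z) = z.
  by rewrite mulrA; case: (hj t) => ->; rewrite ?mulrNN !mul1r.
apply: ub; exists (x t 0) => //=.
(* As [x] agrees with [y] before [t], truncating [x] after index [t] gives a point of the slice.
   Projection feasibility covers lengths up to [d.-1]; at length [d] the projection is [x]
   itself. *)
suff -> : append t y (x t 0) = Defs.proj t.+1 x.
  have [td|] := ltnP t.+1 d.
    by apply: projP => //; rewrite -subn1 ltn_subRL add1n.
  move=> dt; suff -> : Defs.proj t.+1 x = x by [].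
  by apply/colP => s; rewrite mxE (leq_trans (ltn_ord s)).
apply/colP => s; rewrite !mxE ltnS; case: ltngtP => // [/xy //|st].
by rewrite (_ : s = t) //; apply/val_inj.
Qed.

Theorem theorem1 (R : realType) (d n : nat) (hd : (0 < d)%N) (hn : (0 < n)%N)
    (k : 'I_n -> nat) (A : forall i : 'I_n, 'M[R]_(k i, d))
    (b : forall i : 'I_n, 'cV[R]_(k i))
    (hbounded : forall i : 'I_n, bounded_set (polyhedron (A i) (b i)))
    (hflex : forall i : 'I_n, required_flexibility (polyhedron (A i) (b i)))
    (hproj : forall i : 'I_n, projection_feasibility (polyhedron (A i) (b i)))
    (j : 'cV[R]_d) (hj : forall t : 'I_d, j t 0 = -1 \/ j t 0 = 1) :
  is_vertex (minkowski_sum (fun i : 'I_n => polyhedron (A i) (b i)))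
            (\sum_(i < n) extreme_action (polyhedron (A i) (b i)) j).
Proof.
have j0 t : j t 0 != 0 by case: (hj t) => ->; rewrite ?oppr_eq0 oner_eq0.
apply: lex_maximal_vertex (j0) _; apply: lex_maximal_minkowski_sum (j0) _ => i.
exact: extreme_action_lex_maximal.
Qed.
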